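(* Let $\tau,\sigma>0$ satisfy $\tau\sigma\|\mathbf{K}\|^2\le1$, let $$\mathcal{A}=\begin{pmatrix}\partial f&\mathbf{K}^*\\-\mathbf{K}&\partial g^*\end{pmatrix},\qquad \mathcal{M}=\begin{pmatrix}\frac1\tau I&-\mathbf{K}^*\\-\mathbf{K}&\frac1\sigma I\end{pmatrix}$$ on $U\times V$, let $T=(\mathcal{M}+\mathcal{A})^{-1}\mathcal{M}$, and let $\mathcal{M}=\mathcal{C}\mathcal{C}^*$ be a decomposition of $\mathcal{M}$. Let $x^k=(u^k,v^k)$, $y^k=(p^k,q^k)$ and $\varphi_k$ be generated by the aCP algorithm, and let $x^*=(u^*,v^* )$ be a point of $\Omega$. Then (i) $\displaystyle \|R(y^k)\|\le\frac{M_1\rho(L+1)}{\varphi_{k-1}+1}+\frac{2\rho L}{\varphi_{k-2}+1}\|x^0-x^*\|_{\mathcal{M}}$ for all $k\ge2$; (ii) $\displaystyle G(p^k,q^k)\le\frac{M_1M_2\rho(L+1)}{\varphi_{k-1}+1}+\frac{2M_2\rho L}{\varphi_{k-2}+1}\|x^0-x^*\|_{\mathcal{M}}$ for all $k\ge2$, where $$\rho=\sqrt{2\Big(\|\mathbf{K}\|^2+\max\Big\{\frac1{\tau^2},\frac1{\sigma^2}\Big\}\Big)},\qquad L=\max\Big\{\sqrt2\,\sigma,\ \tau\sqrt{8\sigma^2\|\mathbf{K}\|^2+1}\Big\}\|\mathcal{C}\|,$$ $$M_1=\sup_{k\ge1}\max\{\|x^0-x^k\|_{\mathcal{M}},\ \|x^0-Tx^k\|\},\qquad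 M_2=\sup_{k\ge0}\{\|p^k-u^*\|+\|q^k-v^*\|\}.$$
   Context: Setting: $U,V$ are real Hilbert spaces, $f:U\to\mathbb{R}\cup\{+\infty\}$ and $g:V\to\mathbb{R}\cup\{+\infty\}$ are proper, convex and lower semicontinuous, and $\mathbf{K}:U\to V$ is a bounded linear operator with adjoint $\mathbf{K}^*$; $g^*$ is the Fenchel conjugate of $g$. Standing assumption: the problem $\min_{u\in U}f(u)+g(\mathbf{K}u)$ has a solution and $0\in\operatorname{sri}(\operatorname{dom}g-\mathbf{K}(\operatorname{dom}f))$, where $\operatorname{sri}C$ (strong relative interior of a convex set $C$) is the set of $x\in C$ such that the cone generated by $C-x$ equals the closed linear span of $C-x$. $\Omega=\{(u^*,v^* )\in U\times V: 0\in\partial f(u^* )+\mathbf{K}^*v^*,\ 0\in\partial g^*(v^* )-\mathbf{K}u^*\}$. $U\times V$ carries the product inner product; $\langle x,y\rangle_{\mathcal{M}}=\langle\mathcal{M}x,y\rangle$, $\|x\|_{\mathcal{M}}=\sqrt{\langle x,x\rangle_{\mathcal{M}}}$ (a seminorm, since $\mathcal{M}$ is positive semidefinite when $\tau\sigma\|\mathbf{K}\|^2\le1$). In the decomposition $\mathcal{M}=\mathcal{C}\mathcal{C}^*$, $\mathcal{C}:\mathcal{D}\to U\times V$ is a bounded injective linear operator from a real Hilbert space $\mathcal{D}$. $\operatorname{prox}_{\tau f}(y)=\operatorname{argmin}_x\{f(x)+\frac1{2\tau}\|x-y\|^2\}$. aCP algorithm (accelerated Chambolle–Pock): given $x^0=(u^0,v^0)\in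 U\times V$, for $k=0,1,2,\dots$ set $$p^k=\operatorname{prox}_{\tau f}(u^k-\tau\mathbf{K}^*v^k),\qquad q^k=\operatorname{prox}_{\sigma g^*}(\sigma\mathbf{K}(2p^k-u^k)+v^k),$$ $$u^{k+1}=\frac{1}{\varphi_k+1}u^0+\frac{\varphi_k}{\varphi_k+1}p^k,\qquad v^{k+1}=\frac{1}{\varphi_k+1}v^0+\frac{\varphi_k}{\varphi_k+1}q^k,$$ where $x^k=(u^k,v^k)$, $y^k=(p^k,q^k)$ and $\varphi_k=\dfrac{2\langle x^k-y^k,x^0-x^k\rangle_{\mathcal{M}}}{\|x^k-y^k\|_{\mathcal{M}}^2}+1$. It is assumed that $\|x^k-y^k\|_{\mathcal{M}}\ne0$ for all $k\ge0$, so that all $\varphi_k$ are defined. One has $y^k=Tx^k$. Residual mapping: for $x=(u,v)$, $R(x)=\big(u-\operatorname{prox}_f(u-\mathbf{K}^*v),\ v-\operatorname{prox}_{g^*}(v+\mathbf{K}u)\big)$. Primal-dual gap function (relative to $(u^*,v^* )\in\Omega$): $G(u,v)=P(u)+D(v)$ with $P(u)=f(u)-f(u^* )+\langle\mathbf{K}^*v^*,u-u^*\rangle$ and $D(v)=g^*(v)-g^*(v^* )-\langle\mathbf{K}u^*,v-v^*\rangle$. *)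

(* Defs.v *)
From HB Require Import structures.
From mathcomp Require Import all_boot all_order all_algebra.
From mathcomp Require Import all_classical all_reals all_analysis.

Set Implicit Arguments.
Unset Strict Implicit.
Unset Printing Implicit Defensive.
Import Order.TTheory GRing.Theory Num.Theory.
Import numFieldNormedType.Exports.

Local Open Scope classical_set_scope.
Local Open Scope ring_scope.

HB.mixin Record hasInner (R : realType) V of GRing.Lmodule R V := {
  inner : {dot V for idfun} }.

#[short(type="preHilbertType")]
HB.structure Definition PreHilbert (R : realType) :=
  {V of GRing.Lmodule R V & hasInner R V}.

HB.mixin Record isHilbert (R : realType) V
    of PreHilbert R V & CompleteNormedModule R V := {
  inner_norm : forall x : V, inner x x = `|x| ^+ 2 }.

#[short(type="hilbertType")]
HB.structure Definition Hilbert (R : realType) :=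
  {V of PreHilbert R V & CompleteNormedModule R V & isHilbert R V}.

Definition hnorm (R : realType) (V : preHilbertType R) (x : V) : R :=
  Num.sqrt (inner x x).

Lemma hnormE (R : realType) (V : hilbertType R) (x : V) : hnorm x = `|x|.
Proof. by rewrite /hnorm inner_norm sqrtr_sqr normr_id. Qed.

(* The product inner product on U * V. The library norm of the type U * V is
   the max norm; it induces the same topology as hnorm but is used nowhere as
   a norm below. *)
Section ProductInner.
Variables (R : realType) (U V : preHilbertType R).

Definition prod_inner (x y : (U * V)%type) : R :=
  inner x.1 y.1 + inner x.2 y.2.

Let prod_inner_linearl y : GRing.linear_for *%R (prod_inner^~ y).
Proof.
move=> a x z; rewrite /prod_inner /= !linearPl mulrDr /=.
by rewrite addrACA.
Qed.

Let prod_inner_linearr x : GRing.linear_for (idfun \; *%R) (prod_inner x).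
Proof.
move=> a y z; rewrite /prod_inner /= !linearPr /= mulrDr.
by rewrite addrACA.
Qed.

HB.instance Definition _ := bilinear_isBilinear.Build R (U * V)%type (U * V)%type
  R *%R (idfun \; *%R) prod_inner (prod_inner_linearl, prod_inner_linearr).

Let prod_inner_sym (x y : (U * V)%type) :
  prod_inner x y = (-1) ^+ false * idfun (prod_inner y x).
Proof.
by rewrite /prod_inner expr0 mul1r/= (hermC _ x.1) (hermC _ x.2) !expr0 !mul1r.
Qed.

HB.instance Definition _ :=
  isHermitianSesquilinear.Build R (U * V)%type false idfun prod_inner
    prod_inner_sym.

Let inner_ge0 (W : preHilbertType R) (z : W) : 0 <= inner z z.
Proof.
have [->|z0] := eqVneq z 0; first by rewrite linear0r.
exact/ltW/neq0_dnorm_gt0.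
Qed.

Let prod_inner_gt0 (x : (U * V)%type) : x != 0 -> 0 < prod_inner x x.
Proof.
case: x => x y; rewrite /prod_inner xpair_eqE negb_and /= => /orP[x0|y0].
  by rewrite ltr_wpDr ?inner_ge0//; exact: neq0_dnorm_gt0.
by rewrite ltr_wpDl ?inner_ge0//; exact: neq0_dnorm_gt0.
Qed.

HB.instance Definition _ :=
  isDotProduct.Build R (U * V)%type prod_inner prod_inner_gt0.

HB.instance Definition _ := hasInner.Build R (U * V)%type prod_inner.
End ProductInner.

Definition opnorm (R : realType) (U V : preHilbertType R) (K : U -> V) : R :=
  sup [set hnorm (K x) | x in [set x | hnorm x <= 1]].

(* The adjoint is characterized pointwise; for a bounded linear K between
   Hilbert spaces the vector picked by xget exists (Riesz) and is unique, so
   the default 0 is irrelevant. *)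
Definition adjoint (R : realType) (U V : preHilbertType R) (K : U -> V)
    (v : V) : U :=
  xget 0 [set w | forall u, inner (K u) v = inner u w].

Section ConvexSets.
Variables (R : realType) (V : normedModType R).
Implicit Types A C : set V.

Definition linear_subspace A : Prop :=
  A 0 /\ forall (a : R) x y, A x -> A y -> A (a *: x + y).

Definition linear_span A : set V := smallest linear_subspace A.

Definition conic_hull A : set V := [set l *: y | l in [set l : R | 0 < l] & y in A].

Definition sri C : set V :=
  [set x | C x /\ let C' := [set y - x | y in C] in
                  conic_hull C' = closure (linear_span C')].

End ConvexSets.

Section ConvexFunctions.
Local Open Scope ereal_scope.
Variables (R : realType) (V : hilbertType R).
Implicit Types f : V -> \bar R.

Definition edom f : set V := [set x | f x < +oo].

Definition proper_fun f : Prop := (forall x, f x != -oo) /\ edom f !=set0.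

Definition econvex f : Prop := forall (x y : V) (t : R), (0 < t < 1)%R ->
  f (t *: x + (1 - t) *: y)%R <= t%:E * f x + (1 - t)%:E * f y.

Definition fconj f (w : V) : \bar R :=
  ereal_sup (range (fun x => (inner w x)%:E - f x)).

Definition subdiff f (x : V) : set V :=
  [set w | edom f x /\ forall y, f x + (inner w (y - x)%R)%:E <= f y].

(* For f proper, convex and lower semicontinuous and t > 0 the minimizer
   exists and is unique, so the default 0 of xget is irrelevant. *)
Definition prox (t : R) f (y : V) : V :=
  xget 0%R [set p | forall x,
    f p + ((2 * t)^-1 * `|p - y| ^+ 2)%:E <=
    f x + ((2 * t)^-1 * `|x - y| ^+ 2)%:E].

End ConvexFunctions.

(* Single-valued branch of (M + A)^{-1} M for a set-valued operator A. *)
Definition precond_resolvent (X : zmodType) (M : X -> X) (A : X -> set X)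
    (x : X) : X :=
  xget 0 [set y | [set M y + a | a in A y] (M x)].

Section PrimalDual.
Variables (R : realType) (U V : hilbertType R).
Variables (f : U -> \bar R) (g : V -> \bar R) (K : U -> V).
Local Notation X := (U * V)%type.
Local Notation K' := (adjoint K).

Definition primal_solvable : Prop :=
  exists u, forall w, (f u + g (K u) <= f w + g (K w))%E.

Definition qualification : Prop :=
  sri [set b - K a | b in edom g & a in edom f] 0.

Definition Omega : set X :=
  [set x | [set a + K' x.2 | a in subdiff f x.1] 0 /\
           [set b - K x.1 | b in subdiff (fconj g) x.2] 0].

Definition opA (x : X) : set X :=
  [set (a + K' x.2, - K x.1 + b) | a in subdiff f x.1
                                & b in subdiff (fconj g) x.2].

Definition opM (tau sigma : R) (x : X) : X :=
  (tau^-1 *: x.1 - K' x.2, - K x.1 + sigma^-1 *: x.2).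

Definition opT (tau sigma : R) : X -> X :=
  precond_resolvent (opM tau sigma) opA.

Definition innerM (tau sigma : R) (x y : X) : R := inner (opM tau sigma x) y.

Definition normM (tau sigma : R) (x : X) : R :=
  Num.sqrt (innerM tau sigma x x).

(* The iterates are x k = (u^k, v^k) and y k = (p^k, q^k). *)
Definition aCP (tau sigma : R) (x y : nat -> X) (phi : nat -> R) : Prop :=
  forall k,
  [/\ (y k).1 = prox tau f ((x k).1 - tau *: K' (x k).2),
      (y k).2 = prox sigma (fconj g)
                  (sigma *: K (2 *: (y k).1 - (x k).1) + (x k).2),
      phi k = 2 * innerM tau sigma (x k - y k) (x 0%N - x k)
                / normM tau sigma (x k - y k) ^+ 2 + 1,
      (x k.+1).1 = (phi k + 1)^-1 *: (x 0%N).1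
                     + (phi k / (phi k + 1)) *: (y k).1 &
      (x k.+1).2 = (phi k + 1)^-1 *: (x 0%N).2
                     + (phi k / (phi k + 1)) *: (y k).2].

Definition residual (x : X) : X :=
  (x.1 - prox 1 f (x.1 - K' x.2), x.2 - prox 1 (fconj g) (x.2 + K x.1)).

Definition primal_gap (xs : X) (u : U) : \bar R :=
  (f u - f xs.1 + (inner (K' xs.2) (u - xs.1)%R)%:E)%E.

Definition dual_gap (xs : X) (v : V) : \bar R :=
  (fconj g v - fconj g xs.2 - (inner (K xs.1) (v - xs.2)%R)%:E)%E.

Definition gap (xs x : X) : \bar R :=
  (primal_gap xs x.1 + dual_gap xs x.2)%E.

Definition rho_const (tau sigma : R) : R :=
  Num.sqrt (2 * (opnorm K ^+ 2 + Num.max (1 / tau ^+ 2) (1 / sigma ^+ 2))).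

Definition L_const (tau sigma : R) (D : hilbertType R) (C : D -> X) : R :=
  Num.max (Num.sqrt 2 * sigma)
          (tau * Num.sqrt (8 * sigma ^+ 2 * opnorm K ^+ 2 + 1)) * opnorm C.

Definition M1_const (tau sigma : R) (x : nat -> X) : \bar R :=
  ereal_sup [set (Num.max (normM tau sigma (x 0%N - x k))
                          (hnorm (x 0%N - opT tau sigma (x k))))%:E
            | k in [set k | (1 <= k)%N]].

Definition M2_const (xs : X) (y : nat -> X) : \bar R :=
  ereal_sup (range (fun k => (`|(y k).1 - xs.1| + `|(y k).2 - xs.2|)%:E)).

End PrimalDual.

(* Main.v *)
Require Import Defs.
From HB Require Import structures.
From mathcomp Require Import all_boot all_order all_algebra.
From mathcomp Require Import all_classical all_reals all_analysis.
From mathcomp Require Import ring lra.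

Import Order.TTheory GRing.Theory Num.Theory.
Import numFieldNormedType.Exports.
Local Open Scope classical_set_scope.
Local Open Scope ring_scope.

Set Implicit Arguments.
Unset Strict Implicit.
Unset Printing Implicit Defensive.

(** The rates come from three facts about the resolvent [T = (M + A)^-1 M], of
    which the algorithm evaluates [y k = T (x k)].

    The factorization [M = C C^*] turns the seminorm [|z|_M] into the Hilbert norm
    of [C^* z]. Since [A] is monotone, [T] is firmly nonexpansive for this
    seminorm, so [C^* (x k)] follows a Halpern iteration anchored at [C^* (x 0)]
    whose weights [phi k] are computed from the current residual. The choice of
    [phi k] forces [phi k.+1 >= phi k + 1] ([phi_step]), and pairing the residual
    with [x 0 - x*] gives [|x k - y k|_M <= 2 |x 0 - x*|_M / (phi k + 1)]
    ([halpern_residual]).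

    To leave the seminorm, note that [M + A] is block triangular. Its inverse is
    therefore Lipschitz for the genuine norm, and [|T x - T x'| <= L |x - x'|_M]
    ([resolvent_lipschitz] together with [|M z| <= |C| |z|_M]). As [x k] is an
    average of [x 0] and [T (x (k-1))], the distance [|x k - y k|] is bounded by
    [|x 0 - T (x k)| / (phi (k-1) + 1)] plus [L] times a weighted step
    [|x k - x (k-1)|_M], which [halpern_step] and [halpern_residual] control.

    Finally [w = M (x k - y k)] belongs to [A (y k)] and [|w| <= rho |x k - y k|]
    ([hnorm_opM]). Nonexpansiveness of the proximal maps gives [|R (y k)| <= |w|]
    ([hnorm_residual]), and the subgradient inequalities give
    [G (y k) <= <w, y k - x*>] ([gap_le]); Cauchy-Schwarz finishes.

    Proximal points are taken by a choice operator, as are adjoints, so their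
    existence has to be established: [prox_exists] minimizes a strongly convex
    lower semicontinuous function, and the Riesz representation theorem, hence
    the adjoint, follows by applying it to a continuous linear functional. *)

(** * Inner products and the induced norm *)

Section InnerProduct.
Context {R : realType} {V : preHilbertType R}.
Implicit Types x y z : V.

Lemma innerC x y : inner x y = inner y x.
Proof. by rewrite hermC expr0 mul1r. Qed.

Lemma innerDl x y z : inner (x + y) z = inner x z + inner y z.
Proof. exact: linearDl. Qed.

Lemma innerDr x y z : inner x (y + z) = inner x y + inner x z.
Proof. exact: linearDr. Qed.

Lemma innerNl x y : inner (- x) y = - inner x y.
Proof. exact: linearNl. Qed.

Lemma innerNr x y : inner x (- y) = - inner x y.
Proof. exact: linearNr. Qed.

Lemma innerZl a x y : inner (a *: x) y = a * inner x y.
Proof. exact: linearZl_LR. Qed.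

Lemma innerZr a x y : inner x (a *: y) = a * inner x y.
Proof. exact: linearZr_LR. Qed.

Lemma inner0l x : inner 0 x = 0.
Proof. exact: linear0l. Qed.

Definition innerE := (innerDl, innerDr, innerNl, innerNr, innerZl, innerZr).

Lemma inner_ge0 x : 0 <= inner x x.
Proof.
have [->|x0] := eqVneq x 0; first by rewrite inner0l.
exact/ltW/neq0_dnorm_gt0.
Qed.

Lemma inner_eq0 x : inner x x = 0 -> x = 0.
Proof.
move=> xx0; apply/eqP; apply: contraT => x0.
by rewrite -(ltxx (0 : R)) -[X in _ < X]xx0; exact: neq0_dnorm_gt0.
Qed.

(** Vector identities below are proved by pairing both sides with an arbitrary
    vector: this turns them into identities between reals, which [ring] and
    [field] decide. *)
Lemma inner_injl x y : (forall z, inner x z = inner y z) -> x = y.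
Proof.
move=> xy; apply/eqP; rewrite -subr_eq0; apply/eqP/inner_eq0.
by rewrite innerDl innerNl xy subrr.
Qed.

Lemma hnorm_ge0 x : 0 <= hnorm x.
Proof. exact: sqrtr_ge0. Qed.

Lemma sqr_hnorm x : hnorm x ^+ 2 = inner x x.
Proof. by rewrite sqr_sqrtr// inner_ge0. Qed.

Lemma hnorm_le x a : 0 <= a -> inner x x <= a ^+ 2 -> hnorm x <= a.
Proof. by move=> a0 xa; rewrite -(ger0_norm a0) -sqrtr_sqr ler_sqrt ?sqr_ge0. Qed.

Lemma hnorm0 : hnorm (0 : V) = 0.
Proof. by rewrite /hnorm inner0l sqrtr0. Qed.

Lemma hnorm_eq0 x : hnorm x = 0 -> x = 0.
Proof. by move=> x0; apply: inner_eq0; rewrite -sqr_hnorm x0 expr0n. Qed.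

Lemma hnorm_gt0 x : x != 0 -> 0 < hnorm x.
Proof.
move=> x0; rewrite lt_neqAle hnorm_ge0 andbT eq_sym.
by apply: contra_neq x0 => /hnorm_eq0.
Qed.

Lemma hnormZ a x : hnorm (a *: x) = `|a| * hnorm x.
Proof.
by rewrite /hnorm !innerE mulrA -expr2 sqrtrM ?sqr_ge0// sqrtr_sqr.
Qed.

Lemma hnormN x : hnorm (- x) = hnorm x.
Proof. by rewrite -scaleN1r hnormZ normrN1 mul1r. Qed.

(** Cauchy-Schwarz, from the nonnegativity of the squared norm of
    [hnorm y *: x - hnorm x *: y]. *)
Lemma inner_le_hnorm x y : inner x y <= hnorm x * hnorm y.
Proof.
have [->|x0] := eqVneq x 0; first by rewrite inner0l hnorm0 mul0r.
have [->|y0] := eqVneq y 0; first by rewrite innerC inner0l hnorm0 mulr0.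
have hx := hnorm_gt0 x0; have hy := hnorm_gt0 y0.
have := inner_ge0 (hnorm y *: x - hnorm x *: y).
rewrite !innerE -!sqr_hnorm (innerC y x) => h.
rewrite -subr_ge0 -(pmulr_rge0 _ (mulr_gt0 hx hy)) -(pmulr_rge0 _ (@ltr0n R 2)).
by move: h; congr (0 <= _); ring.
Qed.

Lemma hnormD x y : hnorm (x + y) <= hnorm x + hnorm y.
Proof.
apply: hnorm_le; first by rewrite addr_ge0 ?hnorm_ge0.
have := inner_le_hnorm x y.
rewrite !innerE (innerC y x) sqrrD !sqr_hnorm => h; lra.
Qed.

Lemma normr_inner_le x y : `|inner x y| <= hnorm x * hnorm y.
Proof.
rewrite ler_norml inner_le_hnorm andbT -[in leLHS](hnormN x) lerNl.
by rewrite -innerNl inner_le_hnorm.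
Qed.

End InnerProduct.

(** * Existence and variational characterization of proximal points *)

Section Prox.
Context {R : realType} {V : hilbertType R}.
Implicit Types (f : V -> \bar R) (x y z p w : V).

Lemma parallelogram_mid x y z :
  `|2^-1 *: x + (1 - 2^-1) *: y - z| ^+ 2 =
  2^-1 * `|x - z| ^+ 2 + 2^-1 * `|y - z| ^+ 2 - 4^-1 * `|x - y| ^+ 2.
Proof.
rewrite -!inner_norm !innerE (innerC y x) (innerC z x) (innerC z y).
by field.
Qed.

Lemma edom_fin f x : (forall x, f x != -oo%E) -> edom f x ->
  exists r, f x = r%:E.
Proof.
move=> fNy; rewrite /edom /=; case: (f x) (fNy x) => // r _ _.
by exists r.
Qed.

Lemma econvex_fin f x y r s t : (forall x, f x != -oo%E) -> econvex f ->
  f x = r%:E -> f y = s%:E -> 0 < t < 1 ->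
  exists2 q, f (t *: x + (1 - t) *: y) = q%:E & q <= t * r + (1 - t) * s.
Proof.
move=> fNy fcvx fx fy t01; have := fcvx x y t t01.
rewrite fx fy -!EFinM -EFinD.
case: (f _) (fNy (t *: x + (1 - t) *: y)) => // q _.
by rewrite lee_fin; exists q.
Qed.

(** Lower semicontinuity at a point [x0] of the domain bounds [f] below by
    [f x0 - 1] on a ball of some radius [d]; convexity along the segment from
    [x0] to [x] propagates this to a lower bound that is linear in the distance
    to [x0], with slope [2 / d]. This elementary argument replaces the usual
    affine minorant given by Hahn-Banach. *)
Lemma convex_lsc_minorant f :
  proper_fun f -> econvex f -> lower_semicontinuous f ->
  exists a b, forall x r, f x = r%:E -> a - b * `|x| <= r.
Proof.
move=> [fNy [x0 dx0]] fcvx flsc; have [r0 fx0] := edom_fin fNy dx0.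
have r01 : ((r0 - 1)%:E < f x0)%E by rewrite fx0 lte_fin ltrBlDr ltrDl.
have [W /nbhs_ballP[d /= d0 dW] Wf] := flsc x0 _ r01.
have near_x0 x r : `|x - x0| < d -> f x = r%:E -> r0 - 1 < r.
  move=> xx0 fx; rewrite -lte_fin -fx; apply: Wf; apply: dW.
  by rewrite -ball_normE /= distrC.
exists (r0 - 1 - 2 / d * `|x0|), (2 / d) => x r fx.
have dV0 : 0 < 2 / d by rewrite divr_gt0.
have tri : 2 / d * `|x - x0| <= 2 / d * `|x| + 2 / d * `|x0|.
  by rewrite -mulrDr ler_pM2l// ler_normB.
have [xd|dx] := ltP `|x - x0| d.
  have := near_x0 _ _ xd fx.
  have h (z : V) : 0 <= 2 / d * `|z| by rewrite mulr_ge0// ltW.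
  by have := h x; have := h x0; lra.
have xx0 : 0 < `|x - x0| by exact: lt_le_trans dx.
(* t *: x + (1 - t) *: x0 lies at distance d / 2 of x0, inside the ball *)
pose t := d / (2 * `|x - x0|).
have t0 : 0 < t by rewrite divr_gt0// mulr_gt0.
have t1 : t < 1 by rewrite ltr_pdivrMr ?mulr_gt0//; lra.
have [|q fq qle] := econvex_fin (t := t) fNy fcvx fx fx0; first exact/andP.
have : r0 - 1 < q.
  apply: near_x0 fq.
  have -> : t *: x + (1 - t) *: x0 - x0 = t *: (x - x0).
    by rewrite scalerBl scale1r scalerBr addrA addrAC addrK.
  rewrite normrZ gtr0_norm// /t invfM mulrA divfK ?gt_eqF//.
  by rewrite ltr_pdivrMr//; lra.
move=> /lt_le_trans/(_ qle) h.
have tV : 2 / d * `|x - x0| = t^-1 by rewrite /t invf_div; ring.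
have : r0 - t^-1 < r.
  rewrite -(ltr_pM2l t0) mulrBr divff ?gt_eqF//; lra.
lra.
Qed.

(** The objective is bounded below because the quadratic term absorbs the
    linear minorant. Strong convexity (through the parallelogram identity) makes
    every minimizing sequence Cauchy, and lower semicontinuity shows that its
    limit is a minimizer. *)
Lemma prox_exists f y c : 0 < c ->
  proper_fun f -> econvex f -> lower_semicontinuous f ->
  exists p, forall x,
    (f p + (c * `|p - y| ^+ 2)%:E <= f x + (c * `|x - y| ^+ 2)%:E)%E.
Proof.
move=> c0 fproper fcvx flsc.
have [a [b fab]] := convex_lsc_minorant fproper fcvx flsc.
have [fNy [x0 dx0]] := fproper; have [r0 fx0] := edom_fin fNy dx0.
pose S := [set s | exists x r, f x = r%:E /\ s = r + c * `|x - y| ^+ 2].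
have infS : has_inf S.
  split; first by exists (r0 + c * `|x0 - y| ^+ 2), x0, r0.
  (* complete the square in c * s ^+ 2 - `|b| * s, with s = `|x - y| *)
  exists (a - `|b| * `|y| - b ^+ 2 / (4 * c)) => _ [x [r [fx ->]]].
  have h1 : b * `|x| <= `|b| * `|x - y| + `|b| * `|y|.
    rewrite -mulrDr (le_trans (ler_norm _))// normrM normr_id ler_wpM2l//.
    by rewrite -{1}(subrK y x) ler_normD.
  have h2 : 0 <= c * (`|x - y| - `|b| / (2 * c)) ^+ 2.
    by rewrite mulr_ge0 ?sqr_ge0// ltW.
  have h3 : c * (`|x - y| - `|b| / (2 * c)) ^+ 2 =
      c * `|x - y| ^+ 2 - `|b| * `|x - y| + b ^+ 2 / (4 * c).
    by rewrite -(real_normK (num_real b)); field; rewrite gt_eqF.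
  have := fab _ _ fx; lra.
pose m := inf S.
have minf x r : f x = r%:E -> m <= r + c * `|x - y| ^+ 2.
  by move=> fx; apply: ge_inf; [exact: infS.2|exists x, r].
have /choice[ur urP] n : exists xr : V * R,
    f xr.1 = xr.2%:E /\ xr.2 + c * `|xr.1 - y| ^+ 2 < m + n.+1%:R^-1.
  have [||_ [x [r [fx ->]]] h] := @inf_adherent _ S n.+1%:R^-1.
  - by rewrite invr_gt0.
  - exact: infS.
  - by exists (x, r).
pose u n := (ur n).1.
have cau : cauchy (u @ \oo).
  apply/cauchy_ballP => e e0; near_simpl.
  have e1 : 0 < c / 4 * e ^+ 2 by rewrite mulr_gt0 ?exprn_gt0// divr_gt0.
  near=> n k; rewrite -ball_normE /=.
  (* compare m with the objective at the midpoint of u i and u j *)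
  have h i j : c / 4 * `|u i - u j| ^+ 2 < 2^-1 * (i.+1%:R^-1 + j.+1%:R^-1).
    have [fi hi] := urP i; have [fj hj] := urP j.
    have [|q fq qle] := econvex_fin (t := 2^-1) fNy fcvx fi fj; first lra.
    have := minf _ _ fq; rewrite parallelogram_mid -/(u i) -/(u j).
    rewrite -/(u i) in hi; rewrite -/(u j) in hj.
    have -> : c * (2^-1 * `|u i - y| ^+ 2 + 2^-1 * `|u j - y| ^+ 2 -
                   4^-1 * `|u i - u j| ^+ 2) =
      2^-1 * (c * `|u i - y| ^+ 2) + 2^-1 * (c * `|u j - y| ^+ 2) -
      c / 4 * `|u i - u j| ^+ 2 by field.
    move: hi hj qle; set ui := c * _; set uj := c * _; set uij := c / 4 * _.
    set si := i.+1%:R^-1; set sj := j.+1%:R^-1.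
    lra.
  rewrite -(ltr_pXn2r (_ : (0 < 2)%N)) ?nnegrE ?normr_ge0 ?(ltW e0)//.
  rewrite -(ltr_pM2l (_ : 0 < c / 4)) ?divr_gt0//.
  apply: (lt_trans (h n k)).
  have hn : n.+1%:R^-1 < c / 4 * e ^+ 2.
    near: n; exact: near_infty_natSinv_lt (PosNum e1).
  have hk : k.+1%:R^-1 < c / 4 * e ^+ 2.
    near: k; exact: near_infty_natSinv_lt (PosNum e1).
  by move: hn hk; set sn := n.+1%:R^-1; set sk := k.+1%:R^-1; lra.
have /cvg_ex[p up] : cvg (u @ \oo) by exact/cauchy_cvgP.
exists p.
suff pm : (f p + (c * `|p - y| ^+ 2)%:E <= m%:E)%E.
  move=> x; apply: (le_trans pm).
  case fx : (f x) (fNy x) => [r| |] // _; last by rewrite addye// leey.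
  by rewrite -EFinD lee_fin minf.
rewrite leNgt; apply/negP => mlt.
pose w := c * `|p - y| ^+ 2.
have [d d0 fd] : exists2 d, 0 < d & ((m - w + d)%:E < f p)%E.
  case: (f p) mlt (fNy p) => [q| |] // h _.
    move: h; rewrite -EFinD lte_fin -/w => h.
    by exists ((q + w - m) / 2); rewrite ?lte_fin; lra.
  by exists 1; rewrite ?ltry.
have [W Wp Wf] := flsc _ _ fd.
have cw : (fun n => c * `|u n - y| ^+ 2) @ \oo --> w.
  apply: cvgMl_tmp; apply: cvgM => //; apply: cvg_norm; apply: cvgB => //;
  exact: cvg_cst.
have d20 : 0 < d / 2 by rewrite divr_gt0.
near \oo => n.
have [fn hn] := urP n; rewrite -/(u n) in fn hn.
have h1 : m - w + d < (ur n).2.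
  by rewrite -lte_fin -fn; apply: Wf; near: n; exact: up.
have h2 : `|w - c * `|u n - y| ^+ 2| < d / 2.
  by near: n; move/cvgrPdist_lt: cw; exact.
have h3 : n.+1%:R^-1 < d / 2.
  by near: n; exact: near_infty_natSinv_lt (PosNum d20).
move: h2; rewrite ltr_norml => /andP[_].
by move: hn h3; set sn := n.+1%:R^-1; lra.
Unshelve. all: by end_near. Qed.

(** Fermat's rule: comparing the minimizer [p] with [t *: z + (1 - t) *: p] and
    dividing by [t] leaves the subgradient inequality at [z] up to a term
    proportional to [t]. *)
Lemma subdiff_minimizer f c y p : 0 < c -> proper_fun f -> econvex f ->
  (forall x, f p + (c * `|p - y| ^+ 2)%:E <= f x + (c * `|x - y| ^+ 2)%:E)%E ->
  subdiff f p ((2 * c) *: (y - p)).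
Proof.
move=> c0 [fNy [x0 dx0]] fcvx pmin; have [r0 fx0] := edom_fin fNy dx0.
have dp : edom f p.
  rewrite /edom/=; move: (pmin x0); rewrite fx0 -EFinD.
  by case: (f p) => // r _; rewrite ltry.
have [r fp] := edom_fin fNy dp; split=> // z.
case fz : (f z) (fNy z) => [s| |] // _; last by rewrite leey.
rewrite fp -EFinD lee_fin !innerE.
rewrite -subr_ge0; set D := (X in 0 <= X).
have hD t : 0 < t < 1 -> 0 <= D + t * (c * `|z - p| ^+ 2).
  move=> t01; have [t0 t1] := andP t01.
  have [q fq qle] := econvex_fin fNy fcvx fz fp t01.
  move: (pmin (t *: z + (1 - t) *: p)); rewrite fq fp -!EFinD lee_fin => h.
  rewrite -(pmulr_rge0 _ t0).
  have : c * `|t *: z + (1 - t) *: p - y| ^+ 2 = c * `|p - y| ^+ 2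
      + t * (2 * c * (inner p z - inner p p - inner y z + inner y p))
      + t ^+ 2 * (c * `|z - p| ^+ 2).
    rewrite -!inner_norm !innerE (innerC z p) (innerC z y) (innerC p y).
    by field.
  rewrite /D => e; rewrite e in h.
  have : q - r + t * (2 * c * (inner p z - inner p p - inner y z + inner y p))
      + t ^+ 2 * (c * `|z - p| ^+ 2) >= 0 by lra.
  move: qle; lra.
rewrite leNgt; apply/negP => D0.
have A0 : 0 <= c * `|z - p| ^+ 2 by rewrite mulr_ge0 ?sqr_ge0// ltW.
set A := c * _ in hD A0.
(* small enough for t * A < - D, contradicting hD *)
pose t := Num.min 2^-1 (- D / (2 * (A + 1))).
have A1 : 0 < 2 * (A + 1) by lra.
have t01 : 0 < t < 1.
  rewrite /t lt_min gt_min divr_gt0 ?oppr_gt0//; lra.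
have := hD t t01.
have tle : t <= - D / (2 * (A + 1)) by rewrite /t ge_min lexx orbT.
have : t * (2 * (A + 1)) <= - D by rewrite -ler_pdivlMr.
have : 0 <= t * 2 by lra.
nra.
Qed.

Lemma prox_subdiff f t y : 0 < t ->
  proper_fun f -> econvex f -> lower_semicontinuous f ->
  subdiff f (prox t f y) (t^-1 *: (y - prox t f y)).
Proof.
move=> t0 fproper fcvx flsc.
have c0 : 0 < (2 * t)^-1 by rewrite invr_gt0 mulr_gt0.
rewrite /prox; case: xgetP => [p _ pmin|noprox].
  have := subdiff_minimizer c0 fproper fcvx pmin.
  by rewrite invfM mulrA divff ?mul1r ?pnatr_eq0.
have [p pmin] := prox_exists y c0 fproper fcvx flsc.
by have := noprox p; case/(_ pmin).
Qed.

Lemma subdiff_monotone f x y w z : (forall x, f x != -oo%E) ->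
  subdiff f x w -> subdiff f y z -> 0 <= inner (w - z) (x - y).
Proof.
move=> fNy [dx hx] [dy hy].
have [r fx] := edom_fin fNy dx; have [s fy] := edom_fin fNy dy.
move: (hx y) (hy x); rewrite fx fy -!EFinD !lee_fin !innerE; lra.
Qed.

End Prox.

(** * Riesz representation, adjoints and operator norms *)

Section Riesz.
Context {R : realType} {V : hilbertType R}.

Lemma continuous_innerl (v : V) : continuous (fun x : V => inner x v : R^o).
Proof.
move=> x; apply/cvgrPdist_lt => e e0; near=> z.
rewrite -innerNl -innerDl; apply: (le_lt_trans (normr_inner_le _ _)).
rewrite !hnormE.
have v1 : 0 < `|v| + 1 by rewrite ltr_wpDl.
apply: (@le_lt_trans _ _ (`|x - z| * (`|v| + 1))).
  by rewrite ler_wpM2l// lerDl.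
rewrite -ltr_pdivlMr//; near: z; apply/nbhs_normP; exists (e / (`|v| + 1)) => //=.
by rewrite divr_gt0.
Unshelve. all: by end_near. Qed.

(** The representing vector is the proximal point at [0] of [- phi]: Fermat's
    rule there says that [phi h <= inner h p] for all [h], and applying it to
    [- h] gives equality. *)
Lemma riesz (phi : {linear V -> R^o}) : continuous phi ->
  exists w, forall u, phi u = inner u w.
Proof.
move=> cphi; pose f u : \bar R := (- phi u)%:E.
have fproper : proper_fun f by split=> //; exists 0; rewrite /edom/= /f ltry.
have fcvx : econvex f.
  move=> x y t _; rewrite /f -!EFinM -EFinD lee_fin !linearD !linearZ/=.
  by rewrite /GRing.scale/=; lra.
have flsc : lower_semicontinuous f.
  move=> x a; rewrite /f lte_fin => ax.
  exists [set z | a < - phi z].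
    have /cvgr_gt : - phi z @[z --> x] --> (- phi x : R^o).
      by apply: cvgN; exact: cphi.
    by apply.
  by move=> z; rewrite /= lte_fin.
have c0 : 0 < 2^-1 :> R by lra.
have [p pmin] := prox_exists 0 c0 fproper fcvx flsc.
exists p => u; have [_ sub] := subdiff_minimizer c0 fproper fcvx pmin.
have le h : phi h <= inner h p.
  have := sub (p + h); rewrite /f -EFinD lee_fin (linearD phi)/=.
  have -> : p + h - p = h by rewrite addrAC subrr add0r.
  by rewrite sub0r !innerE (innerC h p); lra.
apply/eqP; rewrite eq_le le/=.
by have := le (- u); rewrite linearN innerNl; lra.
Qed.

End Riesz.

Section Adjoint.
Context {R : realType}.

(** The codomain is only a pre-Hilbert space, so that this also covers operators
    into a product of Hilbert spaces. *)
Lemma adjointP {U : hilbertType R} {V : preHilbertType R} (K : {linear U -> V}) :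
  (forall v, continuous (fun u => inner (K u) v : R^o)) ->
  forall u v, inner (K u) v = inner u (adjoint K v).
Proof.
move=> cK u v; rewrite /adjoint; case: xgetP => [w _ -> //|no].
pose phi := fun u => inner (K u) v : R^o.
have lphi : linear phi.
  by move=> a x y; rewrite /phi linearP innerDl innerZl.
pose phiL := GRing.isLinear.Build _ _ _ _ phi lphi.
pose Phi : {linear U -> R^o} := HB.pack phi phiL.
have [w hw] := @riesz _ _ Phi (cK v).
by case: (no w) => z; rewrite -hw.
Qed.

Context {U V : preHilbertType R} (K : {linear U -> V}).
Local Notation K' := (adjoint K).
Hypothesis adjK : forall u v, inner (K u) v = inner u (K' v).

Lemma adj_linear a v w : K' (a *: v + w) = a *: K' v + K' w.
Proof.
apply: inner_injl => u.
by rewrite !innerE ![inner _ u]innerC -!adjK !innerE.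
Qed.

Lemma adjZ a v : K' (a *: v) = a *: K' v.
Proof.
by apply: inner_injl => u; rewrite innerZl ![inner _ u]innerC -!adjK innerZr.
Qed.

Lemma adjB v w : K' (v - w) = K' v - K' w.
Proof. by rewrite addrC -scaleN1r adj_linear scaleN1r addrC. Qed.

Hypothesis bndK : exists M, forall u, hnorm (K u) <= M * hnorm u.

Let opnorm_ubound :
  has_ubound [set hnorm (K u) | u in [set u | hnorm u <= 1]].
Proof.
have [M hM] := bndK; exists `|M| => _ [x /= x1 <-].
apply: (le_trans (hM x)); rewrite -[leRHS]mulr1.
apply: (le_trans (ler_wpM2r (hnorm_ge0 _) (ler_norm M))).
by rewrite ler_wpM2l.
Qed.

Lemma hnorm_le_opnorm u : hnorm (K u) <= opnorm K * hnorm u.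
Proof.
have [->|u0] := eqVneq u 0; first by rewrite linear0 !hnorm0 mulr0.
have hu := hnorm_gt0 u0.
rewrite -ler_pdivrMr//; apply: ub_le_sup; first exact: opnorm_ubound.
exists ((hnorm u)^-1 *: u) => /=.
  by rewrite hnormZ ger0_norm ?invr_ge0 ?hnorm_ge0// mulVf ?gt_eqF.
by rewrite linearZ hnormZ ger0_norm ?invr_ge0 ?hnorm_ge0// mulrC.
Qed.

Lemma opnorm_ge0 : 0 <= opnorm K.
Proof.
apply: ub_le_sup; first exact: opnorm_ubound.
by exists 0; rewrite /= ?linear0 ?hnorm0.
Qed.

Lemma hnorm_adj_le v : hnorm (K' v) <= opnorm K * hnorm v.
Proof.
have [->|w0] := eqVneq (K' v) 0.
  by rewrite hnorm0 mulr_ge0 ?opnorm_ge0 ?hnorm_ge0.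
have hw := hnorm_gt0 w0; rewrite -(ler_pM2l hw) -expr2 sqr_hnorm -adjK.
apply: (le_trans (inner_le_hnorm _ _)).
by rewrite mulrA [_ * opnorm K]mulrC ler_wpM2r ?hnorm_ge0// hnorm_le_opnorm.
Qed.

End Adjoint.

Section BoundedOperators.
Context {R : realType} {U V W : hilbertType R}.

Lemma continuous_inner_comp (K : {linear U -> V}) : continuous K ->
  forall v, continuous (fun u => inner (K u) v : R^o).
Proof.
move=> cK v u; apply: (@continuous_comp _ _ _ K (fun z => inner z v : R^o)).
  exact: cK.
exact: continuous_innerl.
Qed.

Lemma continuous_linear_hnorm (K : {linear U -> V}) : continuous K ->
  exists M, forall u, hnorm (K u) <= M * hnorm u.
Proof.
move=> /linear_bounded_continuous/linear_boundedP/pinfty_ex_gt0[M _ hM].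
by exists M => u; rewrite !hnormE; exact: hM.
Qed.

Lemma continuous_inner_prod (C : {linear W -> (U * V)%type}) : continuous C ->
  forall z, continuous (fun d => inner (C d) z : R^o).
Proof.
move=> cC z d; rewrite /inner/= /prod_inner.
apply: cvgD.
  apply: (@continuous_comp _ _ _ (fst \o C) (fun w => inner w z.1 : R^o)).
    by apply: continuous_comp; [exact: cC|exact: cvg_fst].
  exact: continuous_innerl.
apply: (@continuous_comp _ _ _ (snd \o C) (fun w => inner w z.2 : R^o)).
  by apply: continuous_comp; [exact: cC|exact: cvg_snd].
exact: continuous_innerl.
Qed.

(** The norm of the type [U * V] is the max norm; the factor [2] pays for passing
    from it to the Euclidean norm [hnorm]. *)
Lemma continuous_linear_prod_hnorm (C : {linear W -> (U * V)%type}) :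
  continuous C -> exists M, forall d, hnorm (C d) <= M * hnorm d.
Proof.
move=> /linear_bounded_continuous/linear_boundedP/pinfty_ex_gt0[M M0 hM].
exists (2 * M) => d; rewrite (hnormE d).
apply: hnorm_le; first by rewrite mulr_ge0// mulr_ge0// ltW.
rewrite {1}/inner/= /prod_inner !inner_norm.
have := hM d; rewrite prod_normE ge_max => /andP[h1 h2].
have h0 : 0 <= M * `|d| by rewrite mulr_ge0// ltW.
have : `|(C d).1| ^+ 2 <= (M * `|d|) ^+ 2 by rewrite ler_sqr ?nnegrE.
have : `|(C d).2| ^+ 2 <= (M * `|d|) ^+ 2 by rewrite ler_sqr ?nnegrE.
have := sqr_ge0 (M * `|d|).
rewrite -mulrA [(2 * _) ^+ 2]exprMn; lra.
Qed.

End BoundedOperators.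

(** * Fenchel conjugates *)

Section Conjugate.
Context {R : realType} {V : hilbertType R}.
Implicit Types (g : V -> \bar R) (x w : V).
Local Open Scope ereal_scope.

Lemma fconj_ge g w x : (inner w x)%:E - g x <= fconj g w.
Proof. by apply: ereal_sup_ubound; exists x. Qed.

(** A finite value of the conjugate somewhere is assumed rather than derived from
    an affine minorant of [g]: a primal-dual solution supplies one. *)
Lemma fconj_proper g : proper_fun g -> edom (fconj g) !=set0 ->
  proper_fun (fconj g).
Proof.
move=> [gNy [x0 dx0]] gdom; split=> // w; have [r gx0] := edom_fin gNy dx0.
by rewrite gt_eqF// (lt_le_trans _ (fconj_ge g w x0))// gx0 -EFinB ltNyr.
Qed.

Lemma fconj_convex g : proper_fun g -> econvex (fconj g).
Proof.
move=> [gNy _] w w' t /andP[t0 t1]; apply: ge_ereal_sup => _ [x _ <-].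
have := fconj_ge g w' x; have := fconj_ge g w x.
case: (g x) (gNy x) => [r| |] // _ h h'; last by rewrite leNye.
have -> : (inner (t *: w + (1 - t) *: w')%R x)%:E - r%:E =
    t%:E * ((inner w x)%:E - r%:E) + (1 - t)%:E * ((inner w' x)%:E - r%:E).
  by rewrite -!EFinB -!EFinM -EFinD !innerE; congr _%:E; ring.
by apply: leeD; rewrite lee_wpmul2l// lee_fin; [exact: ltW|lra].
Qed.

Lemma fconj_lsc g : proper_fun g -> lower_semicontinuous (fconj g).
Proof.
move=> [gNy _] w a /ereal_sup_gt[_ [x _ <-]].
case gx : (g x) (gNy x) => [r| |] // _ aw.
exists [set z | (a + r < inner z x)%R].
  have /cvgr_gt := @continuous_innerl _ _ x w; apply.
  by move: aw; rewrite -EFinB lte_fin ltrBrDr.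
move=> z /= az; apply: lt_le_trans (fconj_ge g z x).
by rewrite gx -EFinB lte_fin ltrBrDr.
Qed.

End Conjugate.

(** * Halpern iterations with adaptive anchoring *)

(** The iteration [a k.+1 = (a 0 + phi k *: b k) / (phi k + 1)], where [b k]
    plays the role of [T (a k)] for a firmly nonexpansive map [T] with fixed
    point [s]. Only the two monotonicity inequalities that firm nonexpansiveness
    provides along the orbit enter, so [T] itself does not appear. *)
Section AdaptiveHalpern.
Context {R : realType} {D : preHilbertType R}.
Variables (a b : nat -> D) (phi : nat -> R) (s : D).
Local Notation e k := (a k - b k).

Hypothesis a_rec : forall k,
  a k.+1 = (phi k + 1)^-1 *: a 0%N + (phi k / (phi k + 1)) *: b k.
Hypothesis phi_def : forall k,
  phi k = 2 * inner (e k) (a 0%N - a k) / inner (e k) (e k) + 1.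
Hypothesis e_neq0 : forall k, inner (e k) (e k) != 0.
Hypothesis b_mono : forall j k, 0 <= inner (e j - e k) (b j - b k).
Hypothesis s_zero : forall k, 0 <= inner (e k) (b k - s).

Let e_gt0 k : 0 < inner (e k) (e k).
Proof. by rewrite lt_neqAle eq_sym e_neq0 inner_ge0. Qed.

Lemma inner_anchor k :
  2 * inner (e k) (a 0%N - a k) = (phi k - 1) * inner (e k) (e k).
Proof. by rewrite phi_def addrK divfK. Qed.

Lemma halpern_prev k : 0 < phi k ->
  b k = a k.+1 - (phi k)^-1 *: (a 0%N - a k.+1).
Proof.
move=> p0; apply: inner_injl => z; rewrite a_rec !innerE.
by field; rewrite !gt_eqF// addr_gt0.
Qed.

(** Monotonicity between two consecutive iterates, in which [b k] is eliminated
    through the recursion, reads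
      [|e'|^2 <= <e', q> / phi - <e, q> / phi + <e, e'>],
    with [e], [e'] the residuals at [k] and [k.+1], [q = a 0 - a k.+1] and
    [phi = phi k]. The choice of [phi k] makes [<e, q>] equal to
    [phi / 2 * |e|^2], so that [|e'|^2 <= 2 / phi * <e', q>] by
    [2 <e, e'> <= |e|^2 + |e'|^2]; this is the claim by definition of
    [phi k.+1]. *)
Lemma phi_step k : 0 < phi k -> phi k + 1 <= phi k.+1.
Proof.
move=> p0; have p1 : 0 < phi k + 1 by rewrite addr_gt0.
have aux : inner (e k) (a 0%N - a k.+1) = phi k / 2 * inner (e k) (e k).
  have -> : a 0%N - a k.+1 = (phi k / (phi k + 1)) *: (a 0%N - a k + e k).
    by apply: inner_injl => z; rewrite a_rec !innerE; field; rewrite gt_eqF.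
  rewrite innerZr innerDr.
  have -> : inner (e k) (a 0%N - a k) = (phi k - 1) / 2 * inner (e k) (e k).
    by rewrite mulrAC -inner_anchor mulrAC divff ?mul1r ?pnatr_eq0.
  by field; rewrite gt_eqF.
have := b_mono k.+1 k; rewrite {2}(halpern_prev p0).
have -> : b k.+1 - (a k.+1 - (phi k)^-1 *: (a 0%N - a k.+1)) =
    (phi k)^-1 *: (a 0%N - a k.+1) - e k.+1.
  by apply: inner_injl => z; rewrite !innerE; ring.
rewrite innerDl innerNl !(innerDr _ _ (- e k.+1)) !innerZr !innerNr aux.
set q := inner _ (a 0%N - _).
have : 0 <= inner (e k.+1 - e k) (e k.+1 - e k) by exact: inner_ge0.
rewrite innerDl innerNl !(innerDr _ _ (- e k)) !innerNr.
rewrite [inner (e k.+1) (e k)]innerC.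
have -> : (phi k)^-1 * (phi k / 2 * inner (e k) (e k)) = inner (e k) (e k) / 2.
  by field; rewrite gt_eqF.
set ee := inner (e k) (e k); set ff := inner (e k.+1) (e k.+1).
set ef := inner _ _ => h1 h2.
have : ff / 2 <= (phi k)^-1 * q by lra.
rewrite [leRHS]mulrC ler_pdivlMr// => h3.
by rewrite (phi_def k.+1) lerD2r ler_pdivlMr ?e_gt0// -/q -/ff; lra.
Qed.

Lemma phi_gt0 k : 0 < phi k.
Proof.
elim: k => [|k IH]; first by rewrite phi_def subrr innerC inner0l mulr0 mul0r add0r.
by apply: lt_le_trans (phi_step IH); rewrite addr_gt0.
Qed.

(** Decompose [a 0 - s] as [(a 0 - a k) + e k + (b k - s)] and pair it with [e k]:
    the definition of [phi k] evaluates the first term, the last one is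
    nonnegative, so [(phi k + 1) / 2 * |e k|^2 <= <e k, a 0 - s>]. *)
Lemma halpern_residual k : hnorm (e k) <= 2 / (phi k + 1) * hnorm (a 0%N - s).
Proof.
have p0 := phi_gt0 k; have p1 : 0 < phi k + 1 by rewrite addr_gt0.
have he : 0 < hnorm (e k) by rewrite sqrtr_gt0 e_gt0.
rewrite mulrAC ler_pdivlMr// -(ler_pM2l he) mulrA -expr2 sqr_hnorm.
have := inner_le_hnorm (e k) (a 0%N - s).
have -> : a 0%N - s = (a 0%N - a k) + e k + (b k - s).
  by apply: inner_injl => z; rewrite !innerE; ring.
rewrite 2!innerDr => h.
have := inner_anchor k; have := s_zero k; lra.
Qed.

Lemma halpern_step k :
  phi k * hnorm (a k.+1 - a k) <= hnorm (a 0%N - a k.+1) + phi k * hnorm (e k).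
Proof.
have p0 := phi_gt0 k.
rewrite -{1 2}(gtr0_norm p0) -!hnormZ -[X in _ <= _ + X]hnormN.
apply: le_trans (hnormD _ _); rewrite le_eqVlt; apply/orP; left.
apply/eqP; congr hnorm; rewrite (halpern_prev p0).
by apply: inner_injl => z; rewrite !innerE; field; rewrite gt_eqF.
Qed.

End AdaptiveHalpern.

(** * The preconditioned resolvent of the primal-dual operator *)

Section PrimalDualResolvent.
Context {R : realType} {U V : hilbertType R}.
Variables (f : U -> \bar R) (g : V -> \bar R) (K : {linear U -> V}).
Variables (tau sigma : R).
Local Notation X := (U * V)%type.
Local Notation K' := (adjoint K).
Local Notation opA := (opA f g K).
Local Notation opM := (opM K tau sigma).
Implicit Types x y w : X.

Hypothesis fproper : proper_fun f.
Hypothesis gproper : proper_fun (fconj g).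
Hypothesis adjK : forall u v, inner (K u) v = inner u (K' v).
Hypothesis bndK : exists M, forall u, hnorm (K u) <= M * hnorm u.
Hypotheses (tau0 : 0 < tau) (sigma0 : 0 < sigma).

Lemma prod_innerE x y : inner x y = inner x.1 y.1 + inner x.2 y.2.
Proof. by []. Qed.

Lemma sqr_hnorm_prod x : hnorm x ^+ 2 = `|x.1| ^+ 2 + `|x.2| ^+ 2.
Proof. by rewrite sqr_hnorm prod_innerE !inner_norm. Qed.

Lemma hnorm_prod_le x : hnorm x <= `|x.1| + `|x.2|.
Proof.
apply: hnorm_le; first exact: addr_ge0.
rewrite -sqr_hnorm sqr_hnorm_prod sqrrD.
have : 0 <= `|x.1| * `|x.2| by rewrite mulr_ge0.
lra.
Qed.

Lemma opAE y w : opA y w <->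
  subdiff f y.1 (w.1 - K' y.2) /\ subdiff (fconj g) y.2 (w.2 + K y.1).
Proof.
split=> [[a ha [b hb <-]]/=|[ha hb]].
  by rewrite addrK addrAC addNr add0r.
exists (w.1 - K' y.2) => //; exists (w.2 + K y.1) => //.
by rewrite subrK addrCA addNr addr0; case: w {ha hb}.
Qed.

Lemma Omega_opA x : Omega f g K x <-> opA x 0.
Proof.
rewrite opAE; split=> [[[a ha e1] [b hb e2]]|[ha hb]].
  have -> : (0 : X).1 - K' x.2 = a by rewrite /= -e1 addrK.
  by have -> : (0 : X).2 + K x.1 = b by rewrite /= -e2 subrK.
split; first by exists (0 - K' x.2); rewrite ?subrK.
by exists (0 + K x.1); rewrite ?addrK.
Qed.

(** The skew part [(K' v, - K u)] of [opA] contributes nothing to the pairing, so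
    only the monotonicity of the two subdifferentials is left. *)
Lemma opA_monotone y y' w w' : opA y w -> opA y' w' ->
  0 <= inner (w - w') (y - y').
Proof.
move=> /opAE[h1 h2] /opAE[h1' h2'].
have := subdiff_monotone fproper.1 h1 h1'.
have := subdiff_monotone gproper.1 h2 h2'.
rewrite prod_innerE/= !innerE !adjK ![inner (K' _) _]innerC -!adjK.
rewrite ![inner (K _) _]innerC; lra.
Qed.

(** The estimate behind the Lipschitz continuity of proximal maps, stated on
    differences of points [dp] and of subgradients [da]. *)
Lemma proximal_contraction {H : preHilbertType R} (t : R) (dp da : H) :
  0 < t -> 0 <= inner da dp -> hnorm dp <= t * hnorm (t^-1 *: dp + da).
Proof.
move=> t0 mono; have := inner_le_hnorm (t^-1 *: dp + da) dp.
have [->|dp0] := eqVneq dp 0.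
  by rewrite hnorm0 mulr_ge0 ?hnorm_ge0// ltW.
have hp := hnorm_gt0 dp0.
rewrite innerDl innerZl -sqr_hnorm => h.
rewrite -ler_pdivrMl// -(ler_pM2r hp) -mulrA -expr2; lra.
Qed.

(** Here [y] is the image of [x] under the resolvent, in the form
    [opA y (opM x - opM y)]. The inclusion is triangular, because the off-diagonal
    blocks of [opM] and [opA] cancel in the first line and add up in the second:
    with [w = opM x] it says that [w.1 - y.1 / tau] is a subgradient of [f] at
    [y.1] and that [w.2 + 2 K y.1 - y.2 / sigma] is one of the conjugate of [g]
    at [y.2]. Hence [|dp| <= tau |dw1|] and
    [|dq| <= sigma (|dw2| + 2 |K| |dp|)], and squaring gives the constant. *)
Lemma resolvent_lipschitz x x' y y' :
  opA y (opM x - opM y) -> opA y' (opM x' - opM y') ->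
  hnorm (y - y') <=
  Num.max (Num.sqrt 2 * sigma)
    (tau * Num.sqrt (8 * sigma ^+ 2 * opnorm K ^+ 2 + 1)) *
  hnorm (opM x - opM x').
Proof.
move=> /opAE[h1 h2] /opAE[h1' h2'].
have {h1 h1'}m1 := subdiff_monotone fproper.1 h1 h1'.
have {h2 h2'}m2 := subdiff_monotone gproper.1 h2 h2'.
pose w1 := (opM x - opM x').1; pose w2 := (opM x - opM x').2.
pose dp := y.1 - y'.1; pose dq := y.2 - y'.2.
have hp : `|dp| <= tau * `|w1|.
  rewrite -!hnormE; apply: le_trans (proximal_contraction tau0 m1) _.
  rewrite le_eqVlt; apply/orP; left; apply/eqP; congr (_ * hnorm _).
  by apply: inner_injl => z; rewrite /w1/= !innerE; ring.
have hq : `|dq| <= sigma * (`|w2| + 2 * opnorm K * `|dp|).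
  rewrite -!hnormE; apply: le_trans (proximal_contraction sigma0 m2) _.
  rewrite ler_pM2l//.
  have -> : sigma^-1 *: (y.2 - y'.2) + ((opM x - opM y).2 + K y.1 -
      ((opM x' - opM y').2 + K y'.1)) = w2 + 2 *: K dp.
    by apply: inner_injl => z; rewrite /w2 /dp/= !linearB/= !innerE; ring.
  apply: le_trans (hnormD _ _) _; rewrite lerD2l hnormZ ger0_norm//.
  by rewrite -mulrA ler_pM2l// hnorm_le_opnorm.
set Amax := Num.max _ _.
have A0 : 0 <= Amax by rewrite /Amax le_max mulr_ge0 ?sqrtr_ge0// ltW.
have A1 : 2 * sigma ^+ 2 <= Amax ^+ 2.
  rewrite -[2]sqr_sqrtr// -exprMn ler_sqr ?nnegrE//.
    by rewrite /Amax le_max lexx.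
  by rewrite mulr_ge0 ?sqrtr_ge0// ltW.
have k0 : 0 <= 8 * sigma ^+ 2 * opnorm K ^+ 2 + 1.
  by rewrite addr_ge0// mulr_ge0 ?sqr_ge0// mulr_ge0 ?sqr_ge0.
have A2 : tau ^+ 2 * (8 * sigma ^+ 2 * opnorm K ^+ 2 + 1) <= Amax ^+ 2.
  rewrite -[X in _ * X]sqr_sqrtr// -exprMn ler_sqr ?nnegrE//.
    by rewrite /Amax le_max lexx orbT.
  by rewrite mulr_ge0 ?sqrtr_ge0// ltW.
apply: hnorm_le; first by rewrite mulr_ge0 ?hnorm_ge0.
rewrite -sqr_hnorm exprMn !sqr_hnorm_prod -/w1 -/w2 -/dp -/dq.
have K0 := opnorm_ge0 bndK.
have hq' : `|dq| <= sigma * `|w2| + 2 * sigma * opnorm K * (tau * `|w1|).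
  apply: (le_trans hq); rewrite mulrDr lerD2l [2 * sigma]mulrC -!mulrA.
  by rewrite ler_pM2l// ler_pM2l// ler_wpM2l.
have w10 : 0 <= tau * `|w1| by rewrite mulr_ge0// ltW.
have w20 : 0 <= sigma * `|w2| by rewrite mulr_ge0// ltW.
have c0 : 0 <= 2 * sigma * opnorm K * (tau * `|w1|).
  by rewrite mulr_ge0// mulr_ge0// mulr_ge0// ltW.
have p2 : `|dp| ^+ 2 <= (tau * `|w1|) ^+ 2 by rewrite ler_sqr ?nnegrE.
have q2 : `|dq| ^+ 2 <=
    (sigma * `|w2| + 2 * sigma * opnorm K * (tau * `|w1|)) ^+ 2.
  by rewrite ler_sqr ?nnegrE// addr_ge0.
have yng (s t : R) : (s + t) ^+ 2 <= 2 * s ^+ 2 + 2 * t ^+ 2.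
  by have := sqr_ge0 (s - t); rewrite sqrrB sqrrD; lra.
have := yng (sigma * `|w2|) (2 * sigma * opnorm K * (tau * `|w1|)).
have -> : 2 * (sigma * `|w2|) ^+ 2 +
    2 * (2 * sigma * opnorm K * (tau * `|w1|)) ^+ 2 =
  2 * sigma ^+ 2 * `|w2| ^+ 2 +
  tau ^+ 2 * (8 * sigma ^+ 2 * opnorm K ^+ 2 + 1) * `|w1| ^+ 2 -
  (tau * `|w1|) ^+ 2 by ring.
have := ler_wpM2r (sqr_ge0 `|w2|) A1.
have := ler_wpM2r (sqr_ge0 `|w1|) A2.
lra.
Qed.

(** Two values of the resolvent at [x] coincide by [resolvent_lipschitz]. *)
Lemma opTE x y :
  opA y (opM x - opM y) -> opT f g K tau sigma x = y.
Proof.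
move=> hy; have subE z w : opM z + w = opM x -> w = opM x - opM z.
  by move=> <-; rewrite addrC addKr.
rewrite /opT /precond_resolvent; case: xgetP => [z _ [w hw /subE ew]|no].
  rewrite ew in hw; apply/eqP; rewrite -subr_eq0; apply/eqP/hnorm_eq0.
  apply/eqP; rewrite eq_le hnorm_ge0 andbT.
  by have := resolvent_lipschitz hw hy; rewrite subrr hnorm0 mulr0.
by case: (no y); exists (opM x - opM y); rewrite // addrC subrK.
Qed.

Lemma hnorm_opM x : hnorm (opM x) <= rho_const K tau sigma * hnorm x.
Proof.
have K0 := opnorm_ge0 bndK.
set c := Num.max (1 / tau ^+ 2) (1 / sigma ^+ 2).
have tc : (tau^-1) ^+ 2 <= c by rewrite exprVn /c le_max div1r lexx.
have sc : (sigma^-1) ^+ 2 <= c by rewrite exprVn /c le_max !div1r lexx orbT.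
have c0 : 0 <= c by apply: le_trans tc; exact: sqr_ge0.
have k0 : 0 <= 2 * (opnorm K ^+ 2 + c) by rewrite mulr_ge0// addr_ge0// sqr_ge0.
apply: hnorm_le; first by rewrite mulr_ge0 ?hnorm_ge0// sqrtr_ge0.
rewrite exprMn sqr_sqrtr// -sqr_hnorm !sqr_hnorm_prod/=.
have tri (W : hilbertType R) (a b : W) (s t : R) : 0 <= s -> 0 <= t ->
    `|a| <= s -> `|b| <= t -> `|a - b| ^+ 2 <= 2 * s ^+ 2 + 2 * t ^+ 2.
  move=> s0 t0 as_ bt; apply: (@le_trans _ _ ((s + t) ^+ 2)).
    rewrite ler_sqr ?nnegrE ?addr_ge0//.
    by apply: le_trans (ler_normB _ _) _; exact: lerD.
  by have := sqr_ge0 (s - t); rewrite sqrrB sqrrD; lra.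
have h1 : `|tau^-1 *: x.1 - K' x.2| ^+ 2 <=
    2 * (tau^-1 * `|x.1|) ^+ 2 + 2 * (opnorm K * `|x.2|) ^+ 2.
  apply: tri; rewrite ?mulr_ge0 ?invr_ge0 ?(ltW tau0)//.
    by rewrite normrZ ger0_norm// invr_ge0 ltW.
  by rewrite -!hnormE hnorm_adj_le.
have h2 : `|- K x.1 + sigma^-1 *: x.2| ^+ 2 <=
    2 * (sigma^-1 * `|x.2|) ^+ 2 + 2 * (opnorm K * `|x.1|) ^+ 2.
  rewrite addrC; apply: tri; rewrite ?mulr_ge0 ?invr_ge0 ?(ltW sigma0)//.
    by rewrite normrZ ger0_norm// invr_ge0 ltW.
  by rewrite -!hnormE hnorm_le_opnorm.
have := ler_wpM2r (sqr_ge0 `|x.1|) tc.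
have := ler_wpM2r (sqr_ge0 `|x.2|) sc.
move: h1 h2; rewrite !exprMn -/c; lra.
Qed.

(** If [w] is in [opA y], then [y.1] is the proximal point of
    [y.1 + (w.1 - K' y.2)], which differs by [w.1] from the point where the
    residual evaluates the proximal map; nonexpansiveness concludes, and the
    second component is similar. *)
Lemma hnorm_residual y w : econvex f -> lower_semicontinuous f ->
  econvex (fconj g) -> lower_semicontinuous (fconj g) ->
  opA y w -> hnorm (residual f g K y) <= hnorm w.
Proof.
move=> fcvx flsc gcvx glsc /opAE[h1 h2].
pose r := prox 1 f (y.1 - K' y.2).
pose s := prox 1 (fconj g) (y.2 + K y.1).
have b1 : `|y.1 - r| <= `|w.1|.
  have := subdiff_monotone fproper.1 h1
    (prox_subdiff (y.1 - K' y.2) ltr01 fproper fcvx flsc).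
  rewrite -/r => /(proximal_contraction ltr01).
  rewrite !hnormE mul1r invr1 !scale1r => /le_trans; apply.
  rewrite le_eqVlt; apply/orP; left; apply/eqP; congr `|_|.
  by apply: inner_injl => z; rewrite !innerE; ring.
have b2 : `|y.2 - s| <= `|w.2|.
  have := subdiff_monotone gproper.1 h2
    (prox_subdiff (y.2 + K y.1) ltr01 gproper gcvx glsc).
  rewrite -/s => /(proximal_contraction ltr01).
  rewrite !hnormE mul1r invr1 !scale1r => /le_trans; apply.
  rewrite le_eqVlt; apply/orP; left; apply/eqP; congr `|_|.
  by apply: inner_injl => z; rewrite !innerE; ring.
apply: hnorm_le; first exact: hnorm_ge0.
rewrite -sqr_hnorm !sqr_hnorm_prod.
by apply: lerD; rewrite ler_sqr ?nnegrE.
Qed.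

(** Add the two subgradient inequalities at [xs]; the terms coming from [K] in the
    gap and in [w] cancel. *)
Lemma gap_le y xs w : opA y w -> Omega f g K xs ->
  (gap f g K xs y <= (inner w (y - xs))%:E)%E.
Proof.
move=> /opAE[[dy1 h1] [dy2 h2]] /Omega_opA/opAE[[ds1 _] [ds2 _]].
have [fy e1] := edom_fin fproper.1 dy1; have [fs e2] := edom_fin fproper.1 ds1.
have [gy e3] := edom_fin gproper.1 dy2; have [gs e4] := edom_fin gproper.1 ds2.
have := h1 xs.1; have := h2 xs.2.
rewrite /gap /primal_gap /dual_gap e1 e2 e3 e4 -!(EFinB, EFinD) !lee_fin.
rewrite prod_innerE/= !innerE ![inner (K' _) _]innerC -!adjK.
rewrite ![inner (K _) _]innerC; lra.
Qed.

(** One step of the primal-dual algorithm is an evaluation of the resolvent: both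
    proximal updates are read through Fermat's rule. *)
Lemma prox_steps_opA (u p : U) (v q : V) :
  econvex f -> lower_semicontinuous f ->
  econvex (fconj g) -> lower_semicontinuous (fconj g) ->
  p = prox tau f (u - tau *: K' v) ->
  q = prox sigma (fconj g) (sigma *: K (2 *: p - u) + v) ->
  opA (p, q) (opM (u, v) - opM (p, q)).
Proof.
move=> fcvx flsc gcvx glsc ep eq; apply/opAE; split.
  have := prox_subdiff (u - tau *: K' v) tau0 fproper fcvx flsc.
  rewrite -ep; congr (subdiff _ _ _).
  by apply: inner_injl => z; rewrite /= !innerE; field; rewrite gt_eqF.
have := prox_subdiff (sigma *: K (2 *: p - u) + v) sigma0 gproper gcvx glsc.
rewrite -eq; congr (subdiff _ _ _).
have -> : K (2 *: p - u) = 2 *: K p - K u by rewrite linearB linearZ.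
apply: inner_injl => z; rewrite /= !innerE.
by field; rewrite gt_eqF.
Qed.

End PrimalDualResolvent.

Unset Implicit Arguments.
(** * The convergence rates *)

Theorem theorem4p1 (R : realType) (U V D : hilbertType R)
    (f : U -> \bar R) (g : V -> \bar R) (K : {linear U -> V})
    (tau sigma : R) (C : {linear D -> (U * V)%type})
    (x y : nat -> (U * V)%type) (phi : nat -> R) (xs : (U * V)%type) :
  proper_fun f -> econvex f -> lower_semicontinuous f ->
  proper_fun g -> econvex g -> lower_semicontinuous g ->
  continuous K ->
  primal_solvable f g K -> qualification f g K ->
  0 < tau -> 0 < sigma -> tau * sigma * opnorm K ^+ 2 <= 1 ->
  continuous C -> injective C ->
  (forall z, opM K tau sigma z = C (adjoint C z)) ->
  aCP f g K tau sigma x y phi ->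
  (forall k, normM K tau sigma (x k - y k) != 0) ->
  Omega f g K xs ->
  let rho := rho_const K tau sigma in
  let L := L_const K tau sigma C in
  let M1 := M1_const f g K tau sigma x in
  let M2 := M2_const xs y in
  (forall k, (2 <= k)%N ->
     ((hnorm (residual f g K (y k)))%:E <=
      M1 * (rho * (L + 1) / (phi (k - 1)%N + 1))%:E +
      (2 * rho * L / (phi (k - 2)%N + 1)
         * normM K tau sigma (x 0%N - xs))%:E)%E) /\
  (forall k, (2 <= k)%N ->
     (gap f g K xs (y k) <=
      M1 * M2 * (rho * (L + 1) / (phi (k - 1)%N + 1))%:E +
      M2 * (2 * rho * L / (phi (k - 2)%N + 1)
              * normM K tau sigma (x 0%N - xs))%:E)%E).
Proof.
move=> fproper fcvx flsc gproper gcvx glsc cK _ _ tau0 sigma0 _ cC _ MC.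
move=> alg ne0 Oxs rho L M1 M2.
have adjK := adjointP (continuous_inner_comp cK).
have bndK := continuous_linear_hnorm cK.
have adjC := adjointP (continuous_inner_prod cC).
have bndC := continuous_linear_prod_hnorm cC.
have domg : edom (fconj g) !=set0.
  by case: Oxs => _ [b [h _] _]; exists xs.2.
have hproper := fconj_proper gproper domg.
have hcvx := fconj_convex gproper; have hlsc := fconj_lsc gproper.
pose S := adjoint C.
have SB z w : S (z - w) = S z - S w by exact: adjB.
have Slin c z w : S (c *: z + w) = c *: S z + S w by exact: adj_linear.
have SZ c z : S (c *: z) = c *: S z by exact: adjZ.
have MB z w : opM K tau sigma z - opM K tau sigma w = opM K tau sigma (z - w).
  by rewrite !MC -linearB -/S SB.
have inM z w : innerM K tau sigma z w = inner (S z) (S w).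
  by rewrite /innerM MC adjC.
have nM z : normM K tau sigma z = hnorm (S z) by rewrite /normM inM.
have yA k : opA f g K (y k) (opM K tau sigma (x k) - opM K tau sigma (y k)).
  have [e1 e2 _ _ _] := alg k.
  have := prox_steps_opA fproper hproper tau0 sigma0 fcvx flsc hcvx hlsc e1 e2.
  by rewrite -!surjective_pairing.
have Ty k : opT f g K tau sigma (x k) = y k.
  exact: (opTE fproper hproper bndK tau0 sigma0 (yA k)).
(* the iteration transported to D by S, where the seminorm normM becomes a norm *)
have rec k : S (x k.+1) =
    (phi k + 1)^-1 *: S (x 0%N) + (phi k / (phi k + 1)) *: S (y k).
  have [_ _ _ e1 e2] := alg k.
  have -> : x k.+1 = (phi k + 1)^-1 *: x 0%N + (phi k / (phi k + 1)) *: y k.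
    by rewrite [LHS]surjective_pairing e1 e2.
  by rewrite Slin SZ.
have phiE k : phi k = 2 * inner (S (x k) - S (y k)) (S (x 0%N) - S (x k)) /
    inner (S (x k) - S (y k)) (S (x k) - S (y k)) + 1.
  by have [_ _ -> _ _] := alg k; rewrite inM nM sqr_hnorm !SB.
have eneq k : inner (S (x k) - S (y k)) (S (x k) - S (y k)) != 0.
  by have := ne0 k; rewrite nM SB -sqr_hnorm sqrf_eq0.
have mono j k : 0 <= inner ((S (x j) - S (y j)) - (S (x k) - S (y k)))
    (S (y j) - S (y k)).
  have := opA_monotone fproper hproper adjK (yA j) (yA k).
  by rewrite !MB -/(innerM K tau sigma _ _) inM !SB.
have zero k : 0 <= inner (S (x k) - S (y k)) (S (y k) - S xs).
  have := opA_monotone fproper hproper adjK (yA k) ((Omega_opA _ _ _ _).1 Oxs).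
  by rewrite subr0 !MB -/(innerM K tau sigma _ _) inM !SB.
have p0 k : 0 < phi k := phi_gt0 rec phiE eneq mono k.
have p1 k : 0 < phi k + 1 by rewrite addr_gt0.
have rho0 : 0 <= rho by exact: sqrtr_ge0.
have C0 : 0 <= opnorm C := opnorm_ge0 bndC.
pose A := Num.max (Num.sqrt 2 * sigma)
  (tau * Num.sqrt (8 * sigma ^+ 2 * opnorm K ^+ 2 + 1)).
have A0 : 0 <= A by rewrite /A le_max mulr_ge0 ?sqrtr_ge0// ltW.
have LE : L = A * opnorm C by [].
have L0 : 0 <= L by rewrite LE mulr_ge0.
have lip j k : hnorm (y j - y k) <= L * hnorm (S (x j) - S (x k)).
  apply: le_trans (resolvent_lipschitz fproper hproper bndK tau0 sigma0 (yA j) (yA k)) _.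
  rewrite -/A LE -(mulrA A) ler_wpM2l// MB MC -/S SB; exact: hnorm_le_opnorm.
pose d := normM K tau sigma (x 0%N - xs).
pose m k := Num.max (normM K tau sigma (x 0%N - x k)) (hnorm (x 0%N - y k)).
(* x k.+2 - y k.+2 averages x 0 - y k.+2 and y k.+1 - y k.+2; the Lipschitz
   bound trades the latter for the M-length of a step of the iteration *)
have step k : hnorm (x k.+2 - y k.+2) <=
    (L + 1) / (phi k.+1 + 1) * m k.+2 + 2 * L / (phi k + 1) * d.
  pose t := phi k.+1; pose n := hnorm (S (x k.+2) - S (x k.+1)).
  have t0 : 0 < t + 1 := p1 _.
  have h1 : hnorm (x k.+2 - y k.+2) <=
      (t + 1)^-1 * hnorm (x 0%N - y k.+2) + t / (t + 1) * (L * n).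
    have [_ _ _ e1 e2] := alg k.+1.
    have -> : x k.+2 - y k.+2 = (t + 1)^-1 *: (x 0%N - y k.+2)
        + (t / (t + 1)) *: (y k.+1 - y k.+2).
      have -> : x k.+2 = (t + 1)^-1 *: x 0%N + (t / (t + 1)) *: y k.+1.
        by rewrite [LHS]surjective_pairing e1 e2.
      by apply: inner_injl => z; rewrite !innerE; field; rewrite gt_eqF.
    have c1 : 0 <= (t + 1)^-1 by rewrite invr_ge0 ltW.
    have c2 : 0 <= t / (t + 1) by rewrite mulr_ge0// ltW// p0.
    apply: le_trans (hnormD _ _) _; rewrite !hnormZ !ger0_norm// lerD2l.
    rewrite ler_wpM2l// -hnormN opprB; exact: lip.
  have h2 := halpern_step rec phiE eneq mono k.+1; rewrite -/n -/t in h2.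
  have h3 := halpern_residual rec phiE eneq mono zero k.+1.
  have h4 : hnorm (S (x 0%N) - S (x k.+2)) <= m k.+2.
    by rewrite -SB -nM /m le_max lexx.
  have h5 : hnorm (x 0%N - y k.+2) <= m k.+2 by rewrite /m le_max lexx orbT.
  have d0 : 0 <= d by exact: sqrtr_ge0.
  rewrite -(SB (x 0%N)) -nM -/d -/t in h3.
  (* the residual at k.+1 satisfies the sharper bound with phi k.+1 *)
  have h6 : 2 / (t + 1) * d <= 2 / (phi k + 1) * d.
    rewrite ler_wpM2r// ler_pM2l// lef_pV2 ?posrE// lerD2r.
    by have := phi_step rec phiE eneq mono (p0 k); rewrite -/t; lra.
  apply: (le_trans h1).
  have h7 : t / (t + 1) * (L * n) <=
      L / (t + 1) * m k.+2 + L * (2 / (phi k + 1) * d).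
    have -> : t / (t + 1) * (L * n) = L / (t + 1) * (t * n) by ring.
    have c : 0 <= L / (t + 1) by rewrite mulr_ge0// invr_ge0 ltW.
    apply: (le_trans (ler_wpM2l c h2)); rewrite mulrDr; apply: lerD.
      exact: ler_wpM2l.
    set r := hnorm _.
    have -> : L / (t + 1) * (t * r) = L * (t / (t + 1) * r) by ring.
    rewrite ler_wpM2l//; apply: le_trans h6; apply: le_trans h3.
    by rewrite ler_piMl ?hnorm_ge0// ler_pdivrMr// mul1r lerDl.
  have h8 : (t + 1)^-1 * hnorm (x 0%N - y k.+2) <= (t + 1)^-1 * m k.+2.
    by rewrite ler_wpM2l// invr_ge0 ltW.
  apply: le_trans (lerD h8 h7) _.
  by rewrite le_eqVlt; apply/orP; left; apply/eqP; ring.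
(* m k and n k are the terms of which M1 and M2 are the suprema; the estimates
   hold with them as reals, so infinite suprema need no separate treatment *)
pose c1 k := rho * (L + 1) / (phi k.+1 + 1).
pose c2 k := 2 * rho * L / (phi k + 1) * d.
have c10 k : 0 <= c1 k.
  by rewrite /c1 !mulr_ge0 ?invr_ge0 ?addr_ge0// ltW.
have c20 k : 0 <= c2 k.
  by rewrite /c2 !mulr_ge0 ?invr_ge0 ?sqrtr_ge0// ltW.
have opMb k : hnorm (opM K tau sigma (x k.+2) - opM K tau sigma (y k.+2)) <=
    m k.+2 * c1 k + c2 k.
  rewrite MB; apply: le_trans (hnorm_opM adjK bndK tau0 sigma0 _) _.
  apply: le_trans (ler_wpM2l rho0 (step k)) _.
  by rewrite le_eqVlt /c1 /c2; apply/orP; left; apply/eqP; ring.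
have m0 k : 0 <= m k by rewrite /m le_max sqrtr_ge0.
have mM1 k : ((m k.+2)%:E <= M1)%E.
  by apply: ereal_sup_ubound; exists k.+2 => //=; rewrite Ty.
pose n k := `|(y k).1 - xs.1| + `|(y k).2 - xs.2|.
have n0 k : 0 <= n k by exact: addr_ge0.
have nM2 k : ((n k)%:E <= M2)%E by apply: ereal_sup_ubound; exists k.
split=> -[|[|k]]// _; rewrite ?subn1 ?subn2/= -/rho -/d -/(c1 k) -/(c2 k).
  have := hnorm_residual fproper hproper fcvx flsc hcvx hlsc (yA k.+2).
  move=> /le_trans/(_ (opMb k)) h.
  apply: (@le_trans _ _ ((m k.+2)%:E * (c1 k)%:E + (c2 k)%:E)%E).
    by rewrite -EFinM -EFinD lee_fin.
  by rewrite leeD2r// lee_wpmul2r// lee_fin.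
have := gap_le fproper hproper adjK (yA k.+2) Oxs.
move=> /le_trans; apply.
apply: (@le_trans _ _
  ((m k.+2)%:E * (n k.+2)%:E * (c1 k)%:E + (n k.+2)%:E * (c2 k)%:E)%E).
  rewrite -!EFinM -EFinD lee_fin.
  apply: (le_trans (inner_le_hnorm _ _)).
  have -> : m k.+2 * n k.+2 * c1 k + n k.+2 * c2 k =
    (m k.+2 * c1 k + c2 k) * n k.+2 by ring.
  by rewrite ler_pM ?hnorm_ge0//; exact: hnorm_prod_le.
apply: leeD; rewrite lee_wpmul2r ?lee_fin//.
by rewrite lee_pmul// lee_fin.
Qed.
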